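(* Let $T$ be the binary tree, let $(\alpha_k)_{k\ge0}$ and $(\sigma_k)_{k\ge0}$ be sequences of positive numbers with $(\sigma_k)_{k\ge0}$ non-increasing, and let $X_t=\sigma_{|t|}\sum_{v\preceq t}\alpha_{|v|}\xi_v$, $t\in T$. a) If $X=(X_t)_{t\in T}$ is a.s. bounded, then $$G:=\sup_{n\ge1}\ \sigma_n\sum_{k=1}^n\alpha_k<\infty.$$ b) Moreover, if $(\alpha_k)_{k\ge0}$ satisfies the regularity assumption $$Q:=\sup_{n\ge1}\ \sup_{n\le k\le2n}\frac{\alpha_k}{\alpha_n}<\infty,$$ then $X$ is a.s. bounded if and only if $G<\infty$.
   Context: The binary tree is the infinite rooted tree with root $\mathbf 0$ in which every element has exactly two offspring. $t\preceq s$ means that $t$ lies on the branch connecting $\mathbf 0$ with $s$ (including $t=s$); $t\prec s$ means $t\preceq s$, $t\neq s$; $|s|:=\#\{t\in T:t\prec s\}$. $(\xi_v)_{v\in T}$ are i.i.d. standard normal random variables. $X$ is a.s. bounded means $\mathbb P(\sup_{t\in T}|X_t|<\infty)=1$. *)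

(* Defs.v *)
From HB Require Import structures.
From mathcomp Require Import all_boot all_order all_algebra finmap.
From mathcomp Require Import all_classical all_reals all_analysis.
Set Implicit Arguments.
Unset Strict Implicit.
Unset Printing Implicit Defensive.
Import Order.TTheory GRing.Theory Num.Theory.

Local Open Scope classical_set_scope.
Local Open Scope ring_scope.

(* A vertex is the sequence of left/right choices read from the root, which is
   [::]; the two offspring of t are rcons t false and rcons t true. *)
Definition binary_tree := seq bool.
HB.instance Definition _ := Countable.on binary_tree.

Definition tree_le (t s : binary_tree) : bool := prefix t s.
Definition tree_lt (t s : binary_tree) : bool := tree_le t s && (t != s).

Lemma branchE (t : binary_tree) :
  [set s : binary_tree | tree_le s t] = (fun k => take k t) @` `I_(size t).+1.
Proof.
apply/seteqP; split=> s /=; rewrite /tree_le.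
  move=> st; exists (size s); first by rewrite ltnS size_prefix.
  by move: st; rewrite prefixE => /eqP.
by move=> [k _ <-]; exact: prefix_take.
Qed.

Lemma finite_branch (t : binary_tree) :
  finite_set [set s : binary_tree | tree_le s t].
Proof. by rewrite branchE; apply: finite_image; exact: finite_II. Qed.

(* The cardinality is taken through [fset_set], which is the set itself only
   for finite sets; see [finite_branch] and [depthE]. *)
Definition depth (t : binary_tree) : nat :=
  #|` fset_set [set s : binary_tree | tree_lt s t]|.

Lemma depthE (t : binary_tree) : depth t = size t.
Proof.
apply: card_fset_set.
have -> : [set s : binary_tree | tree_lt s t] =
    (fun k => take k t) @` `I_(size t).
  apply/seteqP; split=> s /=; rewrite /tree_lt /tree_le.
    move=> /andP[st nst]; move: (st); rewrite prefixE => /eqP est.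
    exists (size s) => //=; rewrite ltn_neqAle size_prefix // andbT.
    by apply: contra nst => /eqP e; rewrite -est e take_size.
  move=> [k /= kt <-]; rewrite prefix_take /=.
  apply/eqP => /(congr1 size); rewrite size_take kt => ekt.
  by rewrite ekt ltnn in kt.
apply: inj_card_eq => i j /=; rewrite !inE /= => it jt /(congr1 size).
by rewrite !size_take it jt.
Qed.

Definition mutually_independent (d d' : measure_display)
    (Omega : measurableType d) (E : measurableType d') (R : realType)
    (P : probability Omega R) (I : choiceType) (Y : I -> {RV P >-> E}) : Prop :=
  forall (J : {fset I}) (A : I -> set E),
    (forall i, i \in J -> measurable (A i)) ->
    P (\bigcap_(i in [set` J]) (Y i @^-1` A i)) =
    (\prod_(i <- J) P (Y i @^-1` A i))%E.

Definition iid_standard_normal (d : measure_display)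
    (Omega : measurableType d) (R : realType) (P : probability Omega R)
    (I : choiceType) (xi : I -> {RV P >-> R}) : Prop :=
  mutually_independent xi /\
  forall (i : I) (B : set R), measurable B ->
    distribution P (xi i) B = normal_prob 0 1 B.

Definition as_bounded (d : measure_display) (Omega : measurableType d)
    (R : realType) (P : probability Omega R) (T : Type) (X : T -> Omega -> R) :
    Prop :=
  P [set w | (ereal_sup [set `|X t w|%:E | t in [set: T]] < +oo)%E] = 1%E.

Definition tree_process (R : realType) (Omega : Type) (alpha sigma : nat -> R)
    (xi : binary_tree -> Omega -> R) (t : binary_tree) (w : Omega) : R :=
  sigma (depth t) *
  \sum_(v \in [set v | tree_le v t]) alpha (depth v) * xi v w.

Definition G_sup (R : realType) (alpha sigma : nat -> R) : \bar R :=
  ereal_sup [set (sigma n * \sum_(1 <= k < n.+1) alpha k)%:E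
            | n in [set n | (1 <= n)%N]].

Definition Q_sup (R : realType) (alpha : nat -> R) : \bar R :=
  ereal_sup [set ereal_sup [set (alpha k / alpha n)%:E
                           | k in [set k | (n <= k <= 2 * n)%N]]
            | n in [set n | (1 <= n)%N]].

(* Main.v *)
(* (a) Descend from the root to the first child when its variable is >= 0 and to
   the second child otherwise.  The variables met along this path have Laplace
   transforms at most exp(- kappa a) for small a >= 0, so the weighted sum along
   it exceeds a fixed multiple of alpha_1 + ... + alpha_n with probability
   bounded below uniformly in n; this bounds G once sup |X| <= m has probability
   close to 1.
   (b) Since exp |xi| is integrable and level n has 2^n vertices, almost surely
   the sum of |xi| along every branch of length n is O(n).  Regularity
   says that alpha_k is at most a multiple of the average of alpha_j over
   k/2 <= j <= k, and exchanging the two sums bounds the sum of alpha_k |xi_k|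
   by a multiple of the sum of alpha_k. *)
Require Import Defs.
From mathcomp Require Import all_boot all_order all_algebra.
From mathcomp Require Import all_classical all_reals all_analysis.
From mathcomp Require Import finmap measurable_realfun ring lra zify.
Import Order.TTheory GRing.Theory Num.Theory.

Local Open Scope classical_set_scope.
Local Open Scope ring_scope.
Import HBNNSimple.

Set Implicit Arguments.
Unset Strict Implicit.

(** * From indicators to nonnegative measurable functions *)

(** Linearity extends the identity from indicators to simple functions, and monotone convergence to
    every nonnegative measurable [f]. The weight [Z] is later a normal density, the constant 1, or a
    product of other independent factors. *)
Lemma ge0_integral_eq_indic d d' (T : measurableType d) (T' : measurableType d')
    (R : realType) (m : {measure set T -> \bar R})
    (nu : {measure set T' -> \bar R}) (Z : T -> R) (X : T -> T') (K : R) :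
  measurable_fun setT Z -> (forall w, 0 <= Z w) -> measurable_fun setT X ->
  0 <= K ->
  (forall B, measurable B ->
    \int[m]_w (Z w * \1_B (X w))%:E = K%:E * nu B)%E ->
  forall f : T' -> R, measurable_fun setT f -> (forall x, 0 <= f x) ->
  (\int[m]_w (Z w * f (X w))%:E = K%:E * \int[nu]_x (f x)%:E)%E.
Proof.
move=> mZ Z0 mX K0 ZK f mf f0.
have mEf : measurable_fun [set: T'] (fun x => (f x)%:E) by exact/measurable_EFinP.
pose f_ := nnsfun_approx measurableT mEf.
have f_cvg x : (f_ n x)%:E @[n --> \oo] --> (f x)%:E.
  by apply: (cvg_nnsfun_approx measurableT mEf) => // y _; rewrite lee_fin.
have f_nd x : {homo (fun n => f_ n x) : a b / (a <= b)%N >-> a <= b}.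
  by move=> a b ab; exact/lefP/nd_nnsfun_approx.
have f_ge0 n x : 0 <= f_ n x by [].
have mZf n : measurable_fun setT (fun w => Z w * f_ n (X w)).
  by apply: measurable_funM => //; exact: measurableT_comp.
transitivity (limn (fun n => \int[m]_w (Z w * f_ n (X w))%:E))%E.
  rewrite -monotone_convergence//.
  - apply: eq_integral => w _; apply/esym/cvg_lim => //.
    under eq_fun do rewrite EFinM.
    by rewrite EFinM; apply: cvgeZl => //; exact: f_cvg.
  - by move=> n; exact/measurable_EFinP.
  - by move=> n w _; rewrite lee_fin mulr_ge0.
  - by move=> w _ a b ab; rewrite lee_fin ler_wpM2l// f_nd.
have step n : (\int[m]_w (Z w * f_ n (X w))%:E =
    K%:E * \int[nu]_x (f_ n x)%:E)%E.
  have mfib r : measurable (f_ n @^-1` [set r]) by [].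
  have m1 r : measurable_fun setT (fun w => \1_(f_ n @^-1` [set r]) (X w) : R).
    by apply: (measurableT_comp _ mX); exact: measurable_indic.
  have ge0 r x : 0 <= r * \1_(f_ n @^-1` [set r]) x.
    by have := nnfun_muleindic_ge0 (f_ n) r x; rewrite -EFinM lee_fin.
  transitivity (\int[m]_w (\sum_(r \in range (f_ n))
      (Z w * (r * \1_(f_ n @^-1` [set r]) (X w)))%:E))%E.
    apply: eq_integral => w _; rewrite (fimfunE (f_ n)) fsbig_finite//=.
    by rewrite mulr_sumr -sumEFin fsbig_finite.
  rewrite ge0_integral_fsum//; last 2 first.
    - move=> r; apply/measurable_EFinP/measurable_funM => //.
      exact: measurable_funM.
    - by move=> r w _; rewrite lee_fin mulr_ge0.
  transitivity (K%:E * \int[nu]_x (\sum_(r \in range (f_ n))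
      (r * \1_(f_ n @^-1` [set r]) x)%:E))%E; last first.
    congr (_ * _)%E; apply: eq_integral => x _.
    by rewrite (fimfunE (f_ n)) -fsumEFin.
  rewrite ge0_integral_fsum//; last 2 first.
    - by move=> r; apply/measurable_EFinP/measurable_funM.
    - by move=> r w _; rewrite lee_fin.
  rewrite ge0_mule_fsumr//; last by move=> r; apply: integral_ge0 => x _; rewrite lee_fin.
  apply: eq_fsbigr => r /set_mem [x _ <-].
  set E := f_ n @^-1` _.
  transitivity ((f_ n x)%:E * \int[m]_w (Z w * \1_E (X w))%:E)%E.
    rewrite -ge0_integralZl ?lee_fin//.
    - by apply: eq_integral => w _; rewrite -EFinM mulrCA.
    - apply/measurable_EFinP/measurable_funM => //.
      exact: m1.
    - by move=> w _; rewrite lee_fin mulr_ge0.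
  rewrite ZK//; last exact: mfib.
  transitivity (K%:E * ((f_ n x)%:E * \int[nu]_x0 (\1_E x0)%:E))%E.
    by rewrite integral_indic// ?setIT 1?muleCA//; exact: mfib.
  congr (_ * _)%E; rewrite -ge0_integralZl ?lee_fin//.
  by apply/measurable_EFinP/measurable_indic; exact: mfib.
under eq_fun do rewrite step.
have nd a b : (a <= b)%N ->
    (\int[nu]_x (f_ a x)%:E <= \int[nu]_x (f_ b x)%:E)%E.
  move=> ab; apply: ge0_le_integral => //.
  - by move=> x _; rewrite lee_fin.
  - exact/measurable_EFinP.
  - exact/measurable_EFinP.
  - by move=> x _; rewrite lee_fin f_nd.
rewrite limeMl//; last exact: ereal_nondecreasing_is_cvgn.
congr (_ * _)%E; rewrite -monotone_convergence//.
- by apply: eq_integral => x _; apply/cvg_lim => //; exact: f_cvg.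
- by move=> n; exact/measurable_EFinP.
- by move=> n x _; rewrite lee_fin.
- by move=> x _ a b ab; rewrite lee_fin f_nd.
Qed.

Lemma prod_indic (R : comPzRingType) (I : eqType) (T : Type) (s : seq I)
    (A : I -> set T) (y : I -> T) :
  \prod_(i <- s) (\1_(A i) (y i) : R) =
  (`[< forall i, i \in s -> A i (y i) >])%:R.
Proof.
elim: s => [|i s IHs]; first by rewrite big_nil asboolT.
rewrite big_cons IHs indicE -natrM mulnb; congr (_ _)%:R.
apply/andP/asboolP => [[/set_mem Ai /asboolP As] j|As].
  by rewrite inE => /predU1P[->//|/As].
split; first by apply/mem_set/As; rewrite mem_head.
by apply/asboolP => j js; apply: As; rewrite inE js orbT.
Qed.

(** * Expectation of a product of independent factors *)

Section independence.
Context (d d' : measure_display) (Omega : measurableType d)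
  (E : measurableType d') (R : realType) (P : probability Omega R)
  (I : choiceType) (Y : I -> {RV P >-> E}).
Hypothesis indepY : mutually_independent Y.
Variable f : I -> E -> R.
Hypotheses (mf : forall i, measurable_fun setT (f i))
  (f_ge0 : forall i x, 0 <= f i x)
  (f_fin : forall i, (\int[P]_w (f i (Y i w))%:E < +oo)%E).

Let mY i : measurable_fun setT (Y i).
Proof. exact: measurable_funP. Qed.

Let mfY i : measurable_fun setT (fun w => f i (Y i w)).
Proof. by apply: (measurableT_comp _ (mY i)). Qed.

Let m1Y i (B : set E) : measurable B ->
  measurable_fun setT (fun w => \1_B (Y i w) : R).
Proof.
by move=> mB; apply: (measurableT_comp _ (mY i)); exact: measurable_indic.
Qed.

(** Carrying the indicators over [J] along makes an induction on [s] possible: to replace an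
    indicator of [Y v] by [f v], the identity is needed for all indicators of [Y v], and this is the
    induction hypothesis with [v] moved to [J]. The case of empty [s] is the definition of
    independence. *)
Let integral_prod_indic (s J : seq I) (A : I -> set E) :
  uniq (s ++ J) -> (forall i, measurable (A i)) ->
  (\int[P]_w (\prod_(i <- s) f i (Y i w) *
              \prod_(i <- J) \1_(A i) (Y i w))%:E =
   \prod_(i <- s) \int[P]_w (f i (Y i w))%:E *
   \prod_(i <- J) P (Y i @^-1` A i))%E.
Proof.
elim: s J A => [|v s IHs] J A.
  move=> uJ mA; rewrite big_nil mul1e.
  under eq_integral do rewrite big_nil mul1r.
  have pJ : perm_eq (seq_fset tt J) J.
    by rewrite (perm_trans (seq_fset_perm _ _))// undup_id.
  have := @indepY (seq_fset tt J) A (fun i _ => mA i).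
  rewrite (perm_big _ pJ) => <-.
  rewrite -[X in P X]setIT -integral_indic//; last first.
    apply: fin_bigcap_measurable; first exact: finite_fset.
    move=> i _.
    by rewrite -[X in measurable X]setTI; exact: mY.
  apply: eq_integral => w _; rewrite prod_indic indicE; congr (_ _)%:R%:E.
  apply/asboolP/idP => [AJ|/set_mem AJ i iJ].
    by apply/mem_set => i /= iJ; apply: AJ; rewrite -(seq_fsetE tt).
  by apply: (AJ i) => /=; rewrite (seq_fsetE tt J i).
rewrite cat_cons cons_uniq mem_cat negb_or => /andP[/andP[vs vJ] usJ] mA.
pose Z w := \prod_(i <- s) f i (Y i w) * \prod_(i <- J) (\1_(A i) (Y i w) : R).
have K_fin (F : I -> \bar R) (r : seq I) : (forall i, 0 <= F i)%E ->
    (forall i, F i < +oo)%E ->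
    exists2 K : R, 0 <= K & (\prod_(i <- r) F i = K%:E)%E.
  move=> F_ge0 F_fin; exists (\prod_(i <- r) fine (F i)).
    by apply: prodr_ge0 => i _; exact: fine_ge0.
  rewrite -prodEFin; apply: eq_bigr => i _; rewrite fineK//.
  by rewrite ge0_fin_numE.
have [K1 K10 EK1] : exists2 K : R, 0 <= K &
    (\prod_(i <- s) \int[P]_w (f i (Y i w))%:E = K%:E)%E.
  by apply: K_fin => // i; apply: integral_ge0 => w _; rewrite lee_fin.
have [K2 K20 EK2] : exists2 K : R, 0 <= K &
    (\prod_(i <- J) P (Y i @^-1` A i) = K%:E)%E.
  by apply: K_fin => // i; rewrite (le_lt_trans (probability_le1 _ _)) ?ltry//;
     rewrite -[X in measurable X]setTI; exact: mY.
have Z0 w : 0 <= Z w by rewrite mulr_ge0// prodr_ge0.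
have mZ : measurable_fun setT Z.
  by apply: measurable_funM; apply: measurable_prod => // i _; exact: m1Y.
(* [A'] puts the arbitrary set [B] at the vertex [v]; since [v] is outside [J], the other sets are
   unchanged. *)
have ZK B : measurable B -> (\int[P]_w (Z w * \1_B (Y v w))%:E =
    (K1 * K2)%:E * distribution P (Y v) B)%E.
  move=> mB; pose A' i := if i == v then B else A i.
  have A'J i : i \in J -> A' i = A i.
    by rewrite /A'; case: eqP => // -> vJ'; rewrite vJ' in vJ.
  have A'v : A' v = B by rewrite /A' eqxx.
  have usvJ : uniq (s ++ v :: J).
    by rewrite -cat1s uniq_catCA/= mem_cat negb_or vs vJ.
  have mA' i : measurable (A' i) by rewrite /A'; case: ifP.
  rewrite EFinM -EK1 -EK2 -muleA [X in (_ * X)%E]muleC.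
  transitivity (\prod_(i <- s) \int[P]_w (f i (Y i w))%:E *
      \prod_(i <- v :: J) P (Y i @^-1` A' i))%E.
    rewrite -IHs//; apply: eq_integral => w _; rewrite /Z big_cons A'v -mulrA.
    rewrite [X in _ * X]mulrC; congr (_ * (_ * _))%:E.
    by apply: eq_big_seq => i /A'J ->.
  rewrite big_cons A'v; congr (_ * (_ * _))%E.
  by apply: eq_big_seq => i /A'J ->.
rewrite big_cons EK1 EK2.
have := ge0_integral_eq_indic mZ Z0 (mY v) (mulr_ge0 K10 K20) ZK (mf v) (f_ge0 v).
rewrite ge0_integral_distribution; last 2 first.
- exact/measurable_EFinP.
- by move=> x; rewrite lee_fin.
move=> ZfE; rewrite -muleA -EFinM muleC -ZfE.
by apply: eq_integral => w _; rewrite big_cons -mulrA mulrC.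
Qed.

Lemma integral_prod_independent (s : seq I) : uniq s ->
  (\int[P]_w (\prod_(i <- s) f i (Y i w))%:E =
   \prod_(i <- s) \int[P]_w (f i (Y i w))%:E)%E.
Proof.
move=> us; have := @integral_prod_indic s [::] (fun=> setT).
rewrite cats0 big_nil mule1 => <- //.
by apply: eq_integral => w _; rewrite big_nil mulr1.
Qed.

End independence.

(** * Gaussian integrals *)

Section standard_normal.
Context (R : realType).
Local Notation gamma := (@normal_prob R 0 1).

Lemma integral_normal_prob (m s : R) (f : R -> R) :
  measurable_fun setT f -> (forall x, 0 <= f x) ->
  (\int[normal_prob m s]_x (f x)%:E =
   \int[lebesgue_measure]_x (normal_pdf m s x * f x)%:E)%E.
Proof.
move=> mf f0; rewrite -[LHS]mul1e; apply/esym.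
apply: (ge0_integral_eq_indic (X := id)) => //.
- exact: measurable_normal_pdf.
- by move=> x; exact: normal_pdf_ge0.
- move=> B mB; rewrite mul1e /normal_prob [RHS]integral_mkcond.
  apply: eq_integral => x _; rewrite /patch indicE.
  by case: ifP => _; rewrite ?mulr1 ?mulr0.
Qed.

Lemma measurable_expRMl (c : R) : measurable_fun setT (fun x : R => expR (c * x)).
Proof. by apply: measurableT_comp => //; exact: measurable_funM. Qed.

(** Completing the square: exp (c x) times the density of mean 0 is exp (c^2 / 2) times the density
    of mean c. *)
Lemma mgf_normal_prob (c : R) :
  (\int[gamma]_x (expR (c * x))%:E = (expR (c ^+ 2 / 2))%:E)%E.
Proof.
rewrite integral_normal_prob; [|exact: measurable_expRMl|by move=> x; exact: expR_ge0].
transitivity (\int[lebesgue_measure]_x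
    ((expR (c ^+ 2 / 2))%:E * (normal_pdf c 1 x)%:E))%E.
  apply: eq_integral => x _; rewrite -EFinM; congr EFin.
  rewrite !normal_pdfE ?oner_neq0// /normal_fun mulrCA -!mulrA; congr (_ * _).
  rewrite -!expRD; congr expR; by field.
rewrite ge0_integralZl//.
- by rewrite integral_normal_pdf mule1.
- by apply/measurable_EFinP; exact: measurable_normal_pdf.
- by move=> x _; rewrite lee_fin normal_pdf_ge0.
Qed.

(** exp |x| is at most exp x + exp (- x), and each term integrates to exp (1 / 2). *)
Lemma integral_expR_norm_normal_prob :
  (\int[gamma]_x (expR `|x|)%:E <= (2 * expR (1 / 2))%:E)%E.
Proof.
apply: (@le_trans _ _ (\int[gamma]_x ((expR (1 * x))%:E + (expR (-1 * x))%:E))%E).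
  apply: ge0_le_integral => //.
  - by apply/measurable_EFinP; apply: measurableT_comp => //; exact: measurableT_comp.
  - apply: emeasurable_funD; apply/measurable_EFinP; exact: measurable_expRMl.
  - move=> x _; rewrite -EFinD lee_fin mul1r mulN1r.
    by case: (ler0P x) => _; rewrite ?lerDl ?lerDr expR_ge0.
rewrite ge0_integralD//; last 2 first.
- by apply/measurable_EFinP; exact: measurable_expRMl.
- by apply/measurable_EFinP; exact: measurable_expRMl.
rewrite !mgf_normal_prob -EFinD lee_fin sqrrN expr1n.
by rewrite mulr_natl mulr2n.
Qed.

(** On [1, 2], an interval of length 1, the density is at least its value at 2. This positivity is
    what makes the rate [kappa] of the greedy path positive. *)
Lemma normal_prob_itv1y_gt0 : (0 < gamma `[1%R, +oo[)%E.
Proof.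
apply: (@lt_le_trans _ _ (normal_pdf 0 1 2 : R)%:E).
  rewrite lte_fin normal_pdfE ?oner_neq0// mulr_gt0 ?expR_gt0//.
  by rewrite normal_peak_gt0 ?oner_neq0.
apply: (@le_trans _ _ (\int[lebesgue_measure]_(x in `[1%R, 2%R])
    (normal_pdf 0 1 2 : R)%:E)%E).
  rewrite integral_cst//= lebesgue_measure_itv/= lte_fin.
  rewrite ltr1n -EFinB -EFinM lee_fin; lra.
apply: (@le_trans _ _ (\int[lebesgue_measure]_(x in `[1%R, 2%R])
    (normal_pdf 0 1 x : R)%:E)%E).
  apply: ge0_le_integral => //.
  - by move=> x _; rewrite lee_fin normal_pdf_ge0.
  - by apply/measurable_EFinP/measurable_funTS; exact: measurable_normal_pdf.
  - move=> x /=; rewrite in_itv/= => /andP[x1 x2]; rewrite lee_fin.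
    rewrite !normal_pdfE ?oner_neq0// ler_wpM2l ?normal_peak_ge0//.
    rewrite /normal_fun ler_expR !subr0 ler_wpM2r ?invr_ge0// ?lerN2.
    nra.
apply: ge0_subset_integral => //.
- by apply/measurable_EFinP/measurable_funTS; exact: measurable_normal_pdf.
- by move=> x _; rewrite lee_fin normal_pdf_ge0.
- by move=> x /=; rewrite !in_itv/= => /andP[-> _].
Qed.
End standard_normal.

(** * Weighted sums under the doubling condition *)

(* The doubling condition gives k a_k <= 2 Q \sum_(k/2 <= j <= k) a_j. *)
Lemma sum_doubling_le (R : realFieldType) (a y : nat -> R) (n : nat) (Q C : R) :
  (forall k, 0 <= a k) -> (forall k, 0 <= y k) -> 0 <= C -> 0 <= Q ->
  (forall m k, (1 <= m)%N -> (m <= k <= 2 * m)%N -> a k <= Q * a m) ->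
  (forall m, (m <= n)%N -> \sum_(1 <= k < m.+1) y k <= C * m.+2%:R) ->
  \sum_(1 <= k < n.+1) a k * y k <= 8 * Q * C * \sum_(1 <= k < n.+1) a k.
Proof.
move=> a0 y0 C0 Q0 aQ yC.
pose c j k := (j <= k <= 2 * j)%N.
have ak k : (1 <= k < n.+1)%N ->
    a k <= 2 * Q / k%:R * \sum_(1 <= j < n.+1 | c j k) a j.
  move=> /andP[k1 kn].
  have kR : 0 < k%:R :> R by rewrite ltr0n.
  have cE (F : nat -> R) : \sum_(1 <= j < n.+1 | c j k) F j =
      \sum_(uphalf k <= j < k.+1) F j.
    rewrite [RHS](big_nat_widen _ _ n.+1)//= [RHS](big_nat_widenl _ 1)/=; last by lia.
    by apply: eq_bigl => j; rewrite /c; lia.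
  have : \sum_(1 <= j < n.+1 | c j k) a k <= Q * \sum_(1 <= j < n.+1 | c j k) a j.
    rewrite mulr_sumr big_nat_cond [leRHS]big_nat_cond.
    by apply: ler_sum => j /andP[/andP[j1 _] cjk]; exact: aQ.
  (* The range from [uphalf k] to [k] has more than k / 2 elements, whence the factor 2 / k. *)
  rewrite cE sumr_const_nat => le_aQ.
  rewrite mulrAC ler_pdivlMr// -[2 * Q * _]mulrA.
  have /(le_trans _) := ler_wpM2l (ler0n R 2) le_aQ; apply.
  rewrite -[_ *+ (_ - _)]mulr_natr mulrCA ler_wpM2l// -natrM ler_nat; clear; lia.
apply: (@le_trans _ _ (\sum_(1 <= k < n.+1)
    \sum_(1 <= j < n.+1 | c j k) a j * (2 * Q / k%:R * y k))).
  apply: ler_sum_nat => k kn; rewrite -mulr_suml mulrA ler_wpM2r//.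
  by rewrite mulrC; exact: ak.
rewrite (exchange_big_dep xpredT)//= mulr_sumr.
apply: ler_sum_nat => j /andP[j1 jn].
have jR : 0 < j%:R :> R by rewrite ltr0n.
(* The factor 4 j bounds 2 j + 2, the value of [m.+2] at m = 2 j, since j >= 1. Together with 2 Q /
   j it produces the constant 8 Q C. *)
apply: (@le_trans _ _ (a j * (2 * Q / j%:R * (C * (4 * j%:R))))); last first.
  rewrite le_eqVlt; apply/orP; left; apply/eqP; field; exact: lt0r_neq0.
rewrite -mulr_sumr ler_wpM2l//.
apply: (@le_trans _ _ (\sum_(1 <= k < n.+1 | c j k) 2 * Q / j%:R * y k)).
  rewrite big_nat_cond [leRHS]big_nat_cond; apply: ler_sum => k.
  move=> /andP[_ /andP[jk _]]; rewrite ler_wpM2r// ler_wpM2l ?mulr_ge0//.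
  by rewrite lef_pV2 ?posrE ?ltr0n ?ler_nat// (leq_trans j1).
rewrite -mulr_sumr ler_wpM2l ?divr_ge0 ?mulr_ge0//.
(* The bound on partial sums of [y] is only available up to [n], hence the minimum with 2 j. *)
apply: (@le_trans _ _ (\sum_(1 <= k < (minn n (2 * j)).+1) y k)).
  rewrite [leRHS](big_nat_widen _ _ n.+1) ?ltnS ?geq_minl//.
  rewrite [leLHS]big_mkcond [leRHS]big_mkcond; apply: ler_sum_nat => k kn.
  case: ifP => cjk; last by case: ifP.
  by rewrite ifT//; move: cjk kn; rewrite /c; lia.
rewrite (le_trans (yC _ (geq_minl _ _)))// ler_wpM2l//.
rewrite -natrM ler_nat. have := geq_minr n (2 * j). lia.
Qed.

(** * Branches and levels of the tree as lists *)

Definition branch (t : binary_tree) : seq binary_tree :=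
  [seq take k t | k <- index_iota 0 (size t).+1].

Lemma mem_branch (t v : binary_tree) : (v \in branch t) = tree_le v t.
Proof.
apply/mapP/idP => [[k _ ->]|vt]; first exact: prefix_take.
exists (size v); first by rewrite mem_index_iota ltnS size_prefix.
by move: vt; rewrite /tree_le prefixE => /eqP.
Qed.

Lemma branch_uniq (t : binary_tree) : uniq (branch t).
Proof.
rewrite map_inj_in_uniq ?iota_uniq// => i j.
rewrite !mem_index_iota !ltnS => /andP[_ it] /andP[_ jt] /(congr1 size).
by rewrite !size_takel.
Qed.

Lemma big_branch (R : Type) (idx : R) (op : R -> R -> R) (t : binary_tree)
    (F : binary_tree -> R) :
  \big[op/idx]_(v <- branch t) F v = \big[op/idx]_(0 <= k < (size t).+1) F (take k t).
Proof. by rewrite big_map. Qed.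

(** A branch has exactly one vertex at each depth, namely [take k t], so the sum over a set of
    vertices becomes a sum over depths. *)
Lemma tree_processE (R : realType) (Omega : Type) (alpha sigma : nat -> R)
    (xi : binary_tree -> Omega -> R) (t : binary_tree) (w : Omega) :
  tree_process alpha sigma xi t w =
  sigma (size t) * \sum_(0 <= k < (size t).+1) alpha k * xi (take k t) w.
Proof.
rewrite /tree_process depthE; congr (_ * _).
have -> : [set v | tree_le v t] = [set` branch t].
  by apply/seteqP; split=> v /=; rewrite mem_branch.
rewrite -fsbig_seq ?branch_uniq// big_branch; apply: eq_big_nat => k /andP[_ kt].
by rewrite depthE size_takel.
Qed.

Fixpoint level (n : nat) : seq binary_tree :=
  if n is n'.+1 then
    flatten [seq [:: rcons t false; rcons t true] | t <- level n']
  else [:: [::]].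

Lemma big_level0 (V : nmodType) (F : binary_tree -> V) :
  \sum_(t <- level 0) F t = F [::].
Proof. by rewrite big_seq1. Qed.

Lemma big_levelS (V : nmodType) (n : nat) (F : binary_tree -> V) :
  \sum_(t <- level n.+1) F t =
  \sum_(t <- level n) (F (rcons t false) + F (rcons t true)).
Proof.
rewrite /= big_flatten big_map; apply: eq_bigr => t _.
by rewrite big_cons big_seq1.
Qed.

Lemma mem_level (n : nat) (t : binary_tree) : (t \in level n) = (size t == n).
Proof.
elim: n t => [|n IHn] t; first by rewrite inE size_eq0.
apply/flattenP/eqP => [[_ /mapP[u + ->]]|].
  rewrite IHn => /eqP <-.
  by rewrite !inE => /orP[]/eqP ->; rewrite size_rcons.
case/lastP: t => // t b; rewrite size_rcons => -[tn].
exists [:: rcons t false; rcons t true].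
  by apply/mapP; exists t; rewrite ?IHn ?tn.
by rewrite !inE; case: b; rewrite eqxx ?orbT.
Qed.

(** * Integrals of functions of an i.i.d. normal family *)

Section iid_normal.
Context (d : measure_display) (Omega : measurableType d) (R : realType)
  (P : probability Omega R) (I : choiceType) (xi : I -> {RV P >-> R}).
Hypothesis hxi : iid_standard_normal xi.
Local Notation gamma := (@normal_prob R 0 1).

Lemma integral_iid (i : I) (f : R -> R) :
  measurable_fun setT f -> (forall x, 0 <= f x) ->
  (\int[P]_w (f (xi i w))%:E = \int[gamma]_x (f x)%:E)%E.
Proof.
move=> mf f0; have mxi : measurable_fun setT (xi i) by exact: measurable_funP.
rewrite -[RHS]mul1e.
under eq_integral do rewrite -[f _]mul1r.
apply: (ge0_integral_eq_indic (Z := fun=> 1)) => //.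
move=> B mB.
rewrite mul1e; apply: etrans (hxi.2 i B mB); under eq_integral do rewrite mul1r.
rewrite /distribution /pushforward -[X in P X]setIT -integral_indic//.
by rewrite -[X in measurable X]setTI; exact: mxi.
Qed.

Lemma integral_prod_iid (f : I -> R -> R) (s : seq I) :
  (forall i, measurable_fun setT (f i)) -> (forall i x, 0 <= f i x) ->
  (forall i, \int[gamma]_x (f i x)%:E < +oo)%E -> uniq s ->
  (\int[P]_w (\prod_(i <- s) f i (xi i w))%:E =
   \prod_(i <- s) \int[gamma]_x (f i x)%:E)%E.
Proof.
move=> mf f0 f_fin us.
rewrite (integral_prod_independent hxi.1)//; last by move=> i; rewrite integral_iid.
by apply: eq_bigr => i _; rewrite integral_iid.
Qed.

End iid_normal.

(** * Almost sure boundedness through countably many events *)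

Section boundedness.
Context (d : measure_display) (Omega : measurableType d) (R : realType)
  (P : probability Omega R).

Definition bounded_set (T : Type) (X : T -> Omega -> R) (m : nat) : set Omega :=
  [set w | forall t, `|X t w| <= m%:R].

Lemma ereal_sup_ltyE (T : Type) (X : T -> Omega -> R) :
  [set w | (ereal_sup [set `|X t w|%:E | t in [set: T]] < +oo)%E] =
  \bigcup_m bounded_set X m.
Proof.
apply/seteqP; split => [w /= supX|w [m _ Xm] /=]; last first.
  apply: (@le_lt_trans _ _ (m%:R : R)%:E); last exact: ltry.
  by apply: ge_ereal_sup => _ [t _ <-]; rewrite lee_fin.
have supP t : (`|X t w|%:E <= ereal_sup [set `|X t w|%:E | t in [set: T]])%E.
  by apply: ereal_sup_ubound; exists t.
move: supX supP; set S := ereal_sup _; case: S => [M _ XM|//|_ XM].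
  exists (Num.truncn M).+1 => // t; rewrite -lee_fin (le_trans (XM t))// lee_fin.
  exact/ltW/truncnS_gt.
(* A supremum equal to -oo forces the index type to be empty. *)
by exists 0%N => // t; have := XM t; rewrite leeNy_eq.
Qed.

Lemma measurable_bounded_set (T : countType) (X : T -> Omega -> R) (m : nat) :
  (forall t, measurable_fun setT (X t)) -> measurable (bounded_set X m).
Proof.
move=> mX.
(* Countability of [T] turns the condition into a countable intersection over codes; a number that
   codes no index contributes the whole space. *)
have -> : bounded_set X m = \bigcap_n
    (if @choice.unpickle T n is Some t then [set w | `|X t w| <= m%:R] else setT).
  apply/seteqP; split => [w Xw n _|w Xw t]; first by case: (choice.unpickle n).
  by have := Xw (choice.pickle t) Logic.I; rewrite choice.pickleK.
apply: bigcapT_measurable => n; case: (choice.unpickle n) => // t.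
rewrite -[X in measurable X]setTI.
apply: (@measurable_fun_le _ _ _ setT) => //.
exact: measurableT_comp.
Qed.

Lemma as_boundedP_ae (T : countType) (X : T -> Omega -> R) :
  (forall t, measurable_fun setT (X t)) ->
  (\forall w \ae P, exists M, forall t, `|X t w| <= M) -> as_bounded P X.
Proof.
move=> mX [N [mN PN0 XN]]; rewrite /as_bounded ereal_sup_ltyE.
apply/eqP; rewrite eq_le probability_le1/=; last first.
  by apply: bigcupT_measurable => m; exact: measurable_bounded_set.
have <- : P (~` N) = 1%E by rewrite probability_setC// PN0 sube0.
apply: le_measure; [exact/mem_set/measurableC|apply/mem_set|].
  by apply: bigcupT_measurable => m; exact: measurable_bounded_set.
move=> w Nw; have [M XM] : exists M, forall t, `|X t w| <= M.
  by apply: contrapT => /XN.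
exists (Num.truncn M).+1 => // t; apply: (le_trans (XM t)).
exact/ltW/truncnS_gt.
Qed.

End boundedness.

(** * Linear growth of the sums of |xi| along branches *)

Section branch_sums.
Context (d : measure_display) (Omega : measurableType d) (R : realType)
  (P : probability Omega R) (xi : binary_tree -> {RV P >-> R}).
Hypothesis hxi : iid_standard_normal xi.
Local Notation gamma := (@normal_prob R 0 1).

(** An upper bound for the expectation of exp |xi_v|. *)
Let K : R := 2 * expR (1 / 2).

Let K_gt0 : 0 < K. Proof. by rewrite mulr_gt0 ?expR_gt0. Qed.

(* The factor 4 K makes the expectation of [u n] at most 2^n / 4^(n + 1). *)
Let u n w : R := \sum_(t <- level n) (4 * K) ^- n.+1 *
  \prod_(v <- branch t) expR `|xi v w|.

Let u_ge0 n w : 0 <= u n w.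
Proof.
apply: sumr_ge0 => t _; apply: mulr_ge0; last by apply: prodr_ge0 => v _; exact: expR_ge0.
by rewrite invr_ge0 exprn_ge0// mulr_ge0// ltW.
Qed.

Let mexp v : measurable_fun setT (fun w => expR `|xi v w|).
Proof. by do 2 apply: measurableT_comp => //; exact: measurable_funP. Qed.

Let mprod t : measurable_fun setT (fun w => \prod_(v <- branch t) expR `|xi v w|).
Proof. by apply: measurable_prod. Qed.

Let mu n : measurable_fun setT (u n).
Proof. by apply: measurable_sum => t; exact: measurable_funM. Qed.

Let size_level n : size (level n) = (2 ^ n)%N.
Proof.
elim: n => // n IHn; rewrite /= size_flatten /shape -map_comp sumnE big_map.
by rewrite (eq_bigr (fun=> 2%N))// big_const_seq count_predT iter_addn_0 IHn expnS.
Qed.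

Let integral_branch t :
  (\int[P]_w (\prod_(v <- branch t) expR `|xi v w|)%:E <=
   (K ^+ (size t).+1)%:E)%E.
Proof.
have mexpn : measurable_fun setT (fun x : R => expR `|x|).
  by apply: measurableT_comp => //; exact: measurableT_comp.
have Klty : (\int[gamma]_x (expR `|x|)%:E < +oo)%E.
  by rewrite (le_lt_trans (integral_expR_norm_normal_prob R))// ltry.
rewrite (integral_prod_iid hxi (f := fun _ x => expR `|x|)) ?branch_uniq//.
have e0 : (0 <= \int[gamma]_x (expR `|x|)%:E)%E by apply: integral_ge0.
rewrite -(fineK (x := \int[gamma]_x (expR `|x|)%:E)%E) ?ge0_fin_numE//.
rewrite prodEFin lee_fin big_branch prodr_const_nat subn0 lerXn2r//.
- by rewrite nnegrE fine_ge0.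
- by rewrite nnegrE ltW.
- by rewrite -lee_fin fineK ?ge0_fin_numE// integral_expR_norm_normal_prob.
Qed.

(** Half of the powers of 2 in 4^(n + 1) absorbs the number 2^n of branches; what is left is
    summable in n. *)
Let integral_u n : (\int[P]_w (u n w)%:E <= (1 / (2 ^ n.+1)%:R)%:E)%E.
Proof.
have b0 : 0 <= (4 * K) ^- n.+1 by rewrite invr_ge0 exprn_ge0// mulr_ge0// ltW.
under eq_integral do rewrite /u -sumEFin.
rewrite ge0_integral_sum//; last 2 first.
- by move=> t; apply/measurable_EFinP; exact: measurable_funM.
- by move=> t w _; rewrite lee_fin mulr_ge0// prodr_ge0.
apply: (@le_trans _ _ (\sum_(t <- level n) ((4 * K) ^- n.+1 * K ^+ n.+1)%:E)%E).
  rewrite big_seq [leRHS]big_seq; apply: lee_sum => t; rewrite mem_level => /eqP tn.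
  under eq_integral do rewrite EFinM.
  rewrite ge0_integralZl//; last 2 first.
  - exact/measurable_EFinP.
  - by move=> w _; rewrite lee_fin prodr_ge0.
  by rewrite EFinM lee_wpmul2l// -tn integral_branch.
rewrite sumEFin lee_fin big_const_seq count_predT size_level iter_addr_0.
rewrite -exprVn -exprMn.
have -> : (4 * K)^-1 * K = (2 * 2)^-1 by field; exact: lt0r_neq0.
rewrite invfM exprMn -[_ *+ (2 ^ _)]mulr_natr !natrX -mulrA mul1r exprVn.
rewrite ler_piMr ?invr_ge0 ?exprn_ge0// ler_pdivrMl ?exprn_gt0// mulr1.
by rewrite ler_eXn2l// ltr1n.
Qed.

(** The series [W] of all [u n] has expectation at most 1, hence is almost surely finite. Keeping a
    single branch of level n in [W] bounds the exponential of its sum by W (4 K)^(n + 1), uniformly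
    over all branches; taking logarithms gives linear growth. *)
Lemma ae_branch_sum_le : \forall w \ae P, exists2 C, 0 <= C &
  forall t, \sum_(0 <= k < (size t).+1) `|xi (take k t) w| <= C * (size t).+2%:R.
Proof.
pose W w := (\sum_(0 <= n <oo) (u n w)%:E)%E.
have mEu n : measurable_fun setT (fun w => (u n w)%:E) by exact/measurable_EFinP.
have mW : measurable_fun setT W.
  by apply: ge0_emeasurable_sum => // k w _ _; rewrite lee_fin.
have W0 w : (0 <= W w)%E.
  by apply: nneseries_ge0 => n _ _; rewrite lee_fin.
have iW : (\int[P]_w W w <= 1)%E.
  rewrite integral_nneseries//; last by move=> n w _; rewrite lee_fin.
  apply: (le_trans _ (@epsilon_trick0 R 1 xpredT ler01)).
  apply: lee_nneseries => [n _ _|n _]; last exact: integral_u.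
  by apply: integral_ge0 => w _; rewrite lee_fin.
have : P.-integrable setT W.
  apply/integrableP; split=> //.
  under eq_integral do rewrite gee0_abs//.
  by rewrite (le_lt_trans iW)// ltry.
move=> /(integrable_ae measurableT).
apply: filterS => w /(_ Logic.I) Wfin.
have uW n : u n w <= fine (W w).
  rewrite -lee_fin fineK//; apply: le_trans (nneseries_lim_ge n.+1 _); last first.
    by move=> k _ _; rewrite lee_fin.
  by rewrite big_nat_recr//= leeDr// sume_ge0// => k _; rewrite lee_fin.
exists (fine (W w) + 4 * K).
  by rewrite addr_ge0 ?fine_ge0// mulr_ge0// ltW.
move=> t; set S := \sum_(_ <= _ < _) _; set n := size t.
rewrite -ler_expR.
have K4 : 0 < 4 * K by rewrite mulr_gt0.
have -> : expR S = \prod_(v <- branch t) expR `|xi v w|.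
  by rewrite -expR_sum big_branch.
apply: (@le_trans _ _ (fine (W w) * (4 * K) ^+ n.+1)).
  rewrite -ler_pdivrMr ?exprn_gt0// mulrC (le_trans _ (uW n))// /u.
  have tn : t \in level n by rewrite mem_level.
  rewrite [leRHS](big_rem t)//= lerDl sumr_ge0// => v _.
  by rewrite mulr_ge0 ?invr_ge0 ?exprn_ge0 ?(ltW K4)// prodr_ge0// => ? _;
    exact: expR_ge0.
have W00 : 0 <= fine (W w) by exact: fine_ge0.
(* Using x <= exp x for both [W] and 4 K avoids logarithms; the exponent W + 4 K (n + 1) is then at
   most (W + 4 K) (n + 2). *)
apply: (@le_trans _ _ (expR (fine (W w)) * expR (4 * K) ^+ n.+1)).
  have le_exp (x : R) : x <= expR x.
    by apply: le_trans (expR_ge1Dx x); rewrite lerDr.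
  by rewrite ler_pM ?exprn_ge0 ?(ltW K4)// lerXn2r ?nnegrE ?(ltW K4)// ?expR_ge0.
rewrite -expRM_natr -expRD ler_expR [leRHS]mulrDl.
rewrite lerD//.
  by rewrite ler_peMr// ler1n.
by rewrite ler_wpM2l ?(ltW K4)// ler_nat.
Qed.

End branch_sums.

(** * Sufficiency of finite G under regularity *)

Lemma le_fine_lty (R : realType) (S : \bar R) (x : R) :
  (S < +oo)%E -> (x%:E <= S)%E -> x <= fine S.
Proof. by case: S. Qed.

Lemma measurable_tree_process (d : measure_display) (Omega : measurableType d)
    (R : realType) (P : probability Omega R) (xi : binary_tree -> {RV P >-> R})
    (alpha sigma : nat -> R) (t : binary_tree) :
  measurable_fun setT (tree_process alpha sigma (fun v => xi v : Omega -> R) t).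
Proof.
apply: (eq_measurable_fun (fun w => sigma (size t) *
    \sum_(0 <= k < (size t).+1) alpha k * xi (take k t) w)).
  by move=> w _; rewrite tree_processE.
apply: measurable_funM => //; apply: measurable_sum => k.
by apply: measurable_funM => //; exact: measurable_funP.
Qed.

(** The argument is pathwise: on the almost sure event where branch sums grow linearly, the root
    term is split off and [sum_doubling_le] is applied along the branch of [t], with constants
    independent of [t]. *)
Lemma as_bounded_tree_process (R : realType) (d : measure_display)
    (Omega : measurableType d) (P : probability Omega R)
    (xi : binary_tree -> {RV P >-> R}) (alpha sigma : nat -> R) :
  iid_standard_normal xi ->
  (forall k, 0 < alpha k) -> (forall k, 0 < sigma k) ->
  nonincreasing_seq sigma ->
  (Q_sup alpha < +oo)%E -> (G_sup alpha sigma < +oo)%E ->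
  as_bounded P (tree_process alpha sigma (fun v => xi v : Omega -> R)).
Proof.
move=> hxi alpha_gt0 sigma_gt0 sigma_noninc Qlty Glty.
set Q := fine (Q_sup alpha); set G := fine (G_sup alpha sigma).
have alpha_ge0 k : 0 <= alpha k by exact: ltW.
have sigma_ge0 k : 0 <= sigma k by exact: ltW.
have alphaQ m k : (1 <= m)%N -> (m <= k <= 2 * m)%N -> alpha k <= Q * alpha m.
  move=> m1 mk; rewrite -ler_pdivrMr//; apply: le_fine_lty => //.
  apply: le_trans; last by apply: ereal_sup_ubound; exists m.
  by apply: ereal_sup_ubound; exists k.
have sigmaG n : (1 <= n)%N -> sigma n * \sum_(1 <= k < n.+1) alpha k <= G.
  by move=> n1; apply: le_fine_lty => //; apply: ereal_sup_ubound; exists n.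
have Q0 : 0 <= Q.
  by rewrite -(pmulr_lge0 _ (alpha_gt0 1%N)) (le_trans _ (alphaQ 1%N 1%N _ _)).
have A0 n : 0 <= \sum_(1 <= k < n.+1) alpha k by apply: sumr_ge0.
have G0 : 0 <= G by rewrite (le_trans _ (sigmaG 1%N _))// mulr_ge0.
apply: as_boundedP_ae; first by move=> t; exact: measurable_tree_process.
apply: filterS (ae_branch_sum_le hxi) => w [C C0 leC].
(* The first summand bounds the root term, since the branch sum of the root alone gives |xi| <= 2 C
   there; the second bounds all deeper vertices. *)
exists (sigma 0%N * (alpha 0%N * (C * 2)) + 8 * Q * C * G) => t.
rewrite tree_processE normrM gtr0_norm// big_ltn// take0.
set n := size t.
apply: (@le_trans _ _ (sigma n * (alpha 0%N * (C * 2)) +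
    sigma n * \sum_(1 <= k < n.+1) alpha k * `|xi (take k t) w|)).
  rewrite -mulrDr ler_wpM2l// (le_trans (ler_normD _ _))// lerD//.
    rewrite normrM gtr0_norm// ler_wpM2l//.
    by have := leC [::]; rewrite /= big_nat1.
  rewrite (le_trans (ler_norm_sum _ _ _))// ler_sum// => k _.
  by rewrite normrM gtr0_norm.
apply: lerD.
  by rewrite ler_wpM2r ?mulr_ge0//// sigma_noninc.
have [->|n0] := posnP n.
  by rewrite big_geq// mulr0 !mulr_ge0.
apply: (@le_trans _ _ (sigma n * (8 * Q * C * \sum_(1 <= k < n.+1) alpha k))).
  rewrite ler_wpM2l//.
  apply: (sum_doubling_le (y := fun k => `|xi (take k t) w|)) => //.
  (* Partial sums along [t] are branch sums of the ancestor [take m t], from which the nonnegative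
     root term is dropped. *)
  move=> m mn; have := leC (take m t); rewrite size_takel// big_ltn//.
  move=> /(le_trans _); apply; rewrite ler_wpDl//.
  by apply: ler_sum_nat => k /andP[_ km]; rewrite take_takel.
by rewrite mulrCA ler_wpM2l ?mulr_ge0// sigmaG.
Qed.

(** * The greedy path and its Laplace transform *)

Section greedy_path.
Context (d : measure_display) (Omega : measurableType d) (R : realType)
  (P : probability Omega R) (xi : binary_tree -> {RV P >-> R}).
Hypothesis hxi : iid_standard_normal xi.
Local Notation gamma := (@normal_prob R 0 1).

(* The path chooses the first child rcons t false of t (b = false) iff its
   variable is >= 0.  The product over a branch of these weights is thus
   exp (- \sum_k c_k xi) if the branch is the chosen one, and 0 otherwise; every
   factor depends on a single variable. *)
Definition first_child_weight (a : R) (b : bool) (x : R) : R :=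
  if b then \1_`]-oo, 0[ x else \1_`[0, +oo[ x * expR (- a * x).

Definition second_child_weight (a : R) (b : bool) (x : R) : R :=
  if b then expR (- a * x) else 1.

Definition path_weight (c : nat -> R) (t : binary_tree) (w : Omega) : R :=
  \prod_(0 <= k < size t)
    (first_child_weight (c k) (nth false t k) (xi (rcons (take k t) false) w) *
     second_child_weight (c k) (nth false t k) (xi (rcons (take k t) true) w)).

(** Summed over [b], this is the expectation of exp (- a x), where x is the variable met at one step
    of the greedy path. *)
Definition step_mean (a : R) (b : bool) : R :=
  fine (\int[gamma]_x (first_child_weight a b x)%:E) *
  fine (\int[gamma]_x (second_child_weight a b x)%:E).

Let phi := first_child_weight.
Let psi := second_child_weight.

Let phi_ge0 a b x : 0 <= phi a b x.
Proof. by rewrite /phi /first_child_weight; case: b; rewrite ?mulr_ge0 ?expR_ge0. Qed.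

Let psi_ge0 a b x : 0 <= psi a b x.
Proof. by rewrite /psi /second_child_weight; case: b; rewrite ?expR_ge0. Qed.

Let mphi a b : measurable_fun setT (phi a b).
Proof.
rewrite /phi /first_child_weight; case: b; first exact: measurable_indic.
by apply: measurable_funM; [exact: measurable_indic|exact: measurable_expRMl].
Qed.

Let mpsi a b : measurable_fun setT (psi a b).
Proof.
by rewrite /psi /second_child_weight; case: b => //; exact: measurable_expRMl.
Qed.

Let psi_fin a b : (\int[gamma]_x (psi a b x)%:E < +oo)%E.
Proof.
rewrite /psi /second_child_weight; case: b; first by rewrite mgf_normal_prob ltry.
by rewrite integral_cst// mul1e (le_lt_trans (probability_le1 _ _))// ltry.
Qed.

Let phi_fin a b : (\int[gamma]_x (phi a b x)%:E < +oo)%E.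
Proof.
apply: (@le_lt_trans _ _ (\int[gamma]_x (1 + (expR (- a * x))%:E))%E).
  apply: ge0_le_integral => //.
  - by move=> x _; rewrite lee_fin.
  - by apply/measurable_EFinP; exact: mphi.
  - by apply/measurable_EFinP; apply: measurable_funD => //; exact: measurable_expRMl.
  - move=> x _; rewrite -EFinD lee_fin /phi /first_child_weight !indicE.
    have := expR_ge0 (- a * x).
    by case: b; case: (_ \in _) => /=; rewrite ?mul1r ?mul0r; lra.
rewrite ge0_integralD//; last by apply/measurable_EFinP; exact: measurable_expRMl.
rewrite mgf_normal_prob integral_cst// mul1e.
by rewrite lte_add_pinfty ?ltry// (le_lt_trans (probability_le1 _ _))// ltry.
Qed.

Lemma path_weight_rcons c t b w :
  path_weight c (rcons t b) w = path_weight c t w *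
    (phi (c (size t)) b (xi (rcons t false) w) *
     psi (c (size t)) b (xi (rcons t true) w)).
Proof.
rewrite /path_weight size_rcons big_nat_recr//= -cats1 take_size_cat//.
rewrite nth_cat ltnn subnn/=; congr (_ * _).
by apply: eq_big_nat => k /andP[_ kt]; rewrite takel_cat 1?ltnW// nth_cat kt.
Qed.

(** Rewrites the weight as one function per vertex over a duplicate-free list, the form that
    [integral_prod_iid] accepts. The length bound on [s] is carried along so that the two children
    of [t] are new at each induction step. *)
Let path_weight_factor c t : exists (s : seq binary_tree) (f : binary_tree -> R -> R),
  [/\ uniq s, all (fun v => size v <= size t)%N s,
      [/\ forall v, measurable_fun setT (f v), forall v x, 0 <= f v x &
        forall v, (\int[gamma]_x (f v x)%:E < +oo)%E],
      forall w, path_weight c t w = \prod_(v <- s) f v (xi v w) &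
      (\prod_(v <- s) \int[gamma]_x (f v x)%:E =
        (\prod_(0 <= k < size t) step_mean (c k) (nth false t k))%:E)%E].
Proof.
elim/last_ind: t => [|t b [s [f [us ss [mf f0 f_fin] Vs Es]]]].
  (* [psi 0 false] is the constant 1, an admissible default over the empty list. *)
  exists [::], (fun _ => psi 0 false); split => //.
  - by move=> w; rewrite /path_weight big_geq// big_nil.
  - by rewrite big_geq// big_nil.
set v0 := rcons t false; set v1 := rcons t true; set a := c (size t).
exists [:: v0, v1 & s], (fun v => if v == v0 then phi a b else
  if v == v1 then psi a b else f v).
have v10 : v1 != v0 by rewrite /v0 /v1 eqseq_rcons andbF.
have v0s : v0 \notin s.
  by apply/negP => /(allP ss); rewrite size_rcons ltnn.
have v1s : v1 \notin s.
  by apply/negP => /(allP ss); rewrite size_rcons ltnn.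
have sv v : v \in s -> (v == v0 = false) * (v == v1 = false).
  by move=> vs; split; apply/negP => /eqP vE; move: v0s v1s; rewrite -vE vs.
split.
- by rewrite /= inE negb_or eq_sym v10 v0s v1s us.
- rewrite /= !size_rcons !leqnn/=; apply: sub_all ss => v /leq_trans; apply.
  by rewrite leqnSn.
- by split=> [v|v x|v]; case: ifP => // _; case: ifP.
- move=> w; rewrite path_weight_rcons Vs !big_cons !eqxx (negbTE v10) mulrC.
  rewrite mulrA; congr (_ * _ * _).
  by apply: eq_big_seq => v /sv[-> ->].
- rewrite !big_cons !eqxx (negbTE v10).
  rewrite (eq_big_seq (fun v => \int[gamma]_x (f v x)%:E)%E); last first.
    by move=> v /sv[-> ->].
  rewrite Es size_rcons big_nat_recr//= nth_rcons ltnn eqxx muleA muleC EFinM.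
  congr (_ * _)%E.
    congr EFin; apply: eq_big_nat => k /andP[_ kt].
    by rewrite nth_rcons kt.
  rewrite /step_mean EFinM !fineK// ge0_fin_numE ?phi_fin ?psi_fin//.
  + by apply: integral_ge0 => x _; rewrite lee_fin; exact: psi_ge0.
  + by apply: integral_ge0 => x _; rewrite lee_fin; exact: phi_ge0.
Qed.

Lemma integral_path_weight c t :
  (\int[P]_w (path_weight c t w)%:E =
   (\prod_(0 <= k < size t) step_mean (c k) (nth false t k))%:E)%E.
Proof.
have [s [f [us _ [mf f0 f_fin] Vs <-]]] := path_weight_factor c t.
under eq_integral do rewrite Vs.
exact: integral_prod_iid.
Qed.

Lemma measurable_path_weight c t : measurable_fun setT (path_weight c t).
Proof.
apply: measurable_prod => k _; apply: measurable_funM.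
- by apply: (measurableT_comp (mphi _ _)).
- by apply: (measurableT_comp (mpsi _ _)).
Qed.

Lemma path_weight_ge0 c t w : 0 <= path_weight c t w.
Proof.
by apply: prodr_ge0 => k _; apply: mulr_ge0; [exact: phi_ge0|exact: psi_ge0].
Qed.

(** Distributivity: expanding the product on the right chooses one bit per step, and the vertices of
    level n are these choices. *)
Lemma sum_level_prod (g : nat -> bool -> R) n :
  \sum_(t <- level n) \prod_(0 <= k < n) g k (nth false t k) =
  \prod_(0 <= k < n) (g k false + g k true).
Proof.
elim: n => [|n IHn]; first by rewrite big_level0 !big_geq.
rewrite big_levelS big_nat_recr//= -IHn big_distrl/=.
rewrite big_seq [RHS]big_seq; apply: eq_bigr => t; rewrite mem_level => /eqP tn.
rewrite !big_nat_recr//= !nth_rcons tn ltnn eqxx mulrDr.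
by congr (_ * _ + _ * _); apply: eq_big_nat => k /andP[_ kn];
  rewrite nth_rcons tn kn.
Qed.

(** The witness is the greedy path itself: the bit appended is the truth value of
    [xi (rcons t false) w < 0], so every indicator in the weight equals 1. The variable of step k
    sits at depth k + 1. *)
Lemma exists_path_weight c n w : exists2 t, size t = n &
  path_weight c t w = expR (- \sum_(0 <= k < n) c k * xi (take k.+1 t) w).
Proof.
elim: n => [|n [t tn IHt]].
  by exists [::] => //; rewrite /path_weight !big_geq// oppr0 expR0.
exists (rcons t (xi (rcons t false) w < 0)); first by rewrite size_rcons tn.
rewrite path_weight_rcons IHt big_nat_recr//= opprD expRD.
have tk (b : bool) : take n.+1 (rcons t b) = rcons t b.
  by rewrite take_oversize// size_rcons tn.
rewrite tk tn; congr (expR (- _) * _).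
  by apply: eq_big_nat => k /andP[_ kn]; rewrite -cats1 takel_cat// tn.
rewrite /phi /psi /first_child_weight /second_child_weight.
case: ltP => xi0; rewrite indicE mem_set ?mul1r ?mulr1 ?mulNr//=.
by rewrite in_itv/= xi0.
Qed.

Lemma step_mean_ge0 a b : 0 <= step_mean a b.
Proof.
by rewrite mulr_ge0// fine_ge0// integral_ge0// => x _; rewrite lee_fin;
  [exact: phi_ge0|exact: psi_ge0].
Qed.

Let q : R := fine (gamma `[1, +oo[).

(** Let p be the mass of the negative half-line. A nonnegative first child contributes at most 1 - p
    - q (1 - exp (- a)), a loss of first order in a, while the second child contributes p exp (a^2 /
    2), an excess of second order only. For a <= q / 4 the loss q a / 2 exceeds the excess by at
    least q a / 4. *)
Let step_mean_le_q a : 0 <= a <= q / 4 ->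
  step_mean a false + step_mean a true <= expR (- (q / 4 * a)).
Proof.
move=> /andP[a0 aq].
have fin_gamma A : measurable A -> gamma A \is a fin_num.
  by move=> mA; exact: fin_num_measure.
have q0 : 0 <= q by exact: fine_ge0.
have q1 : q <= 1.
  by rewrite -lee_fin fineK ?fin_gamma// probability_le1.
pose p : R := fine (gamma `]-oo, 0[).
have p0 : 0 <= p by exact: fine_ge0.
have p1 : p <= 1.
  by rewrite -lee_fin fineK ?fin_gamma// probability_le1.
have gamma0y : gamma `[0, +oo[ = (1 - p)%:E.
  rewrite EFinB fineK ?fin_gamma// -probability_setC//.
  by rewrite setCitvl.
pose J : R := fine (\int[gamma]_x (phi a false x)%:E)%E.
have EJ : (\int[gamma]_x (phi a false x)%:E = J%:E)%E.
  rewrite fineK// ge0_fin_numE ?phi_fin// integral_ge0// => x _.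
  by rewrite lee_fin; exact: phi_ge0.
(* Pointwise, the integrand of [J] plus 1 - exp (- a) on [1, +oo[ stays below the indicator of [0,
   +oo[; the gain comes from the mass [q]. *)
have Jle : J + (1 - expR (- a)) * q <= 1 - p.
  rewrite -lee_fin EFinD EFinM -EJ fineK ?fin_gamma// -gamma0y.
  have ea : 0 <= 1 - expR (- a) by rewrite subr_ge0 expR_le1 oppr_le0.
  have m1 : measurable_fun setT (fun x : R => \1_`[1, +oo[ x : R).
    exact: measurable_indic.
  have gammaE A : measurable A -> (gamma A = \int[gamma]_x (\1_A x)%:E)%E.
    by move=> mA; rewrite integral_indic// setIT.
  rewrite !gammaE//.
  rewrite -ge0_integralZl//; last exact/measurable_EFinP.
  rewrite -ge0_integralD//; last 4 first.
  - by move=> x _; rewrite lee_fin; exact: phi_ge0.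
  - by apply/measurable_EFinP; exact: mphi.
  - by move=> x _; rewrite -EFinM lee_fin mulr_ge0.
  - by apply/measurable_EFinP; exact: measurable_funM.
  apply: ge0_le_integral => //.
  - move=> x _; rewrite -EFinM -EFinD lee_fin.
    by rewrite addr_ge0 ?mulr_ge0//; exact: phi_ge0.
  - apply/measurable_EFinP; apply: measurable_funD; first exact: mphi.
    exact: measurable_funM.
  - by apply/measurable_EFinP; exact: measurable_indic.
  move=> x _; rewrite -EFinM -EFinD lee_fin /phi /first_child_weight !indicE.
  rewrite !mem_setE !in_itv/= !andbT.
  have [x0|x0] := leP 0 x; last first.
    by rewrite [1 <= x]leNgt (lt_trans x0 ltr01)/= mul0r mulr0 addr0.
  rewrite mul1r; have [x1|x1] := leP 1 x.
    by rewrite mulr1 -lerBrDr opprB addrC subrK ler_expR mulNr lerN2 ler_peMr.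
  by rewrite mulr0 addr0 expR_le1 mulNr oppr_le0 mulr_ge0.
have meanF : step_mean a false = J.
  rewrite /step_mean /second_child_weight integral_cst// mul1e -[RHS]mulr1.
  congr (_ * _); exact: (congr1 fine (probability_setT (normal_prob 0 1))).
have meanT : step_mean a true = p * expR (a ^+ 2 / 2).
  rewrite /step_mean /second_child_weight mgf_normal_prob sqrrN.
  by rewrite /first_child_weight integral_indic// setIT.
rewrite meanF meanT.
set u := a ^+ 2 / 2.
have u0 : 0 <= u by rewrite /u divr_ge0// sqr_ge0.
have u1 : 2 * u <= a * (q / 4).
  by rewrite /u mulrC divfK// expr2 ler_wpM2l.
have au : u <= 1 / 2 by nra.
(* From exp (- u) >= 1 - u one gets exp u <= 1 / (1 - u), which is at most 1 + 2 u for u <= 1 /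
   2. *)
have expu : expR u <= 1 + 2 * u.
  have := expR_ge1Dx (- u); have := expRxMexpNx_1 u; have := expR_gt0 u.
  by set x := expR u; set y := expR (- u); nra.
(* Here exp (- a) <= 1 / (1 + a) <= 1 - a / 2, valid for 0 <= a <= 1. *)
have expa : expR (- a) <= 1 - a / 2.
  have := expR_ge1Dx a; have := expRxMexpNx_1 a; have := expR_gt0 (- a).
  by set x := expR a; set y := expR (- a); nra.
apply: le_trans (expR_ge1Dx _).
have : p * expR u <= p * (1 + 2 * u) by rewrite ler_wpM2l.
have : q * (a / 2) <= (1 - expR (- a)) * q by rewrite mulrC ler_wpM2r//; lra.
nra.
Qed.
Lemma step_mean_le : exists2 kappa, 0 < kappa & forall a, 0 <= a <= kappa ->
  step_mean a false + step_mean a true <= expR (- (kappa * a)).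
Proof.
exists (q / 4); last exact: step_mean_le_q.
rewrite divr_gt0// fine_gt0// normal_prob_itv1y_gt0/=.
by rewrite (le_lt_trans (probability_le1 _ _))// ltry.
Qed.

End greedy_path.

(** * Necessity of finite G *)

(** A Markov inequality for the total path weight [V] of level n: its expectation is at most exp (-
    kappa^2), yet [V] is at least [b] whenever |X| <= m. As the latter event has probability above
    exp (- kappa^2 / 2), [b] cannot exceed exp (- kappa^2 / 2), which unfolds to the bound 4 m /
    kappa on G. *)
Lemma G_sup_lty (R : realType) (d : measure_display)
    (Omega : measurableType d) (P : probability Omega R)
    (xi : binary_tree -> {RV P >-> R}) (alpha sigma : nat -> R) :
  iid_standard_normal xi ->
  (forall k, 0 < alpha k) -> (forall k, 0 < sigma k) ->
  nonincreasing_seq sigma ->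
  as_bounded P (tree_process alpha sigma (fun v => xi v : Omega -> R)) ->
  (G_sup alpha sigma < +oo)%E.
Proof.
move=> hxi alpha_gt0 sigma_gt0 sigma_noninc.
set X := tree_process _ _ _; rewrite /as_bounded ereal_sup_ltyE => PX.
have mX m : measurable (bounded_set X m).
  by apply: measurable_bounded_set => t; exact: measurable_tree_process.
have [kappa kappa0 mean_le] := step_mean_le R.
(* The threshold lies strictly between exp (- kappa^2) and 1. Continuity from below provides [m],
   fixed before [n], so the final bound is uniform in [n]. *)
have [m Pm] : exists m, ((expR (- (kappa * kappa / 2)))%:E < P (bounded_set X m))%E.
  apply: contrapT => /forallNP Pm.
  have : ((expR (- (kappa * kappa / 2)))%:E < P (\bigcup_m bounded_set X m))%E.
    by rewrite PX lte_fin expR_lt1 oppr_lt0 divr_gt0// mulr_gt0.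
  apply/negP; rewrite -leNgt.
  have cvgP : P (bounded_set X m) @[m --> \oo] --> P (\bigcup_m bounded_set X m).
    apply: nondecreasing_cvg_mu => //; first exact: bigcupT_measurable.
    move=> a b ab; apply/subsetPset => w Xw t; rewrite (le_trans (Xw t))//.
    by rewrite ler_nat.
  rewrite -(cvg_lim _ cvgP)//; apply: lime_le.
    by apply/cvg_ex; eexists; exact: cvgP.
  by apply: nearW => k; rewrite leNgt; apply/negP; exact: Pm.
apply: (@le_lt_trans _ _ (4 * m%:R / kappa)%:E); last exact: ltry.
apply: ge_ereal_sup => _ [n /= n1 <-]; rewrite lee_fin.
set A := \sum_(_ <= _ < _) _.
have alpha_ge0 k : 0 <= alpha k by exact: ltW.
have leA k : (k < n)%N -> alpha k.+1 <= A.
  move=> kn; rewrite /A (big_cat_nat _ (n := k.+1))//=; last by rewrite ltnS ltnW.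
  rewrite [X in _ + X]big_ltn ?ltnS//.
  by rewrite addrCA lerDl addr_ge0// sumr_ge0.
have A0 : 0 < A by rewrite (lt_le_trans (alpha_gt0 1%N))// leA.
(* Normalised so that the n weights sum to [kappa], hence each is at most [kappa], the range of
   [mean_le]. The shift to [alpha k.+1] reflects that step k leads to depth k + 1. *)
pose c k := kappa / A * alpha k.+1.
have sumc : \sum_(0 <= k < n) c k = kappa.
  by rewrite -mulr_sumr -(big_add1 _ _ 0 n.+1 xpredT alpha) divfK// lt0r_neq0.
have c_int k : (k < n)%N -> 0 <= c k <= kappa.
  move=> kn; rewrite mulr_ge0 ?divr_ge0 ?(ltW kappa0) ?(ltW A0)//=.
  by rewrite /c mulrAC ler_pdivrMr// ler_wpM2l ?(ltW kappa0)// leA.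
pose V w := \sum_(t <- level n) path_weight xi c t w.
have mV : measurable_fun setT V.
  by apply: measurable_sum => t; exact: measurable_path_weight.
have V0 w : 0 <= V w by apply: sumr_ge0 => t _; exact: path_weight_ge0.
have iV : (\int[P]_w (V w)%:E <= (expR (- (kappa * kappa)))%:E)%E.
  under eq_integral do rewrite /V -sumEFin.
  rewrite ge0_integral_sum//; last 2 first.
  - by move=> t; apply/measurable_EFinP; exact: measurable_path_weight.
  - by move=> t w _; rewrite lee_fin; exact: path_weight_ge0.
  rewrite (eq_big_seq (fun t => (\prod_(0 <= k < n)
      step_mean (c k) (nth false t k))%:E)); last first.
    by move=> t; rewrite mem_level => /eqP <-; exact: integral_path_weight.
  rewrite sumEFin lee_fin (sum_level_prod (fun k => step_mean (c k))).
  rewrite -[X in _ <= expR (- (_ * X))]sumc mulr_sumr -sumrN expR_sum.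
  rewrite !big_mkord; apply: ler_prod => -[i ltin] _.
  by rewrite addr_ge0 ?step_mean_ge0 ?mean_le ?c_int.
(* When |X| <= m, the sum over the non-root vertices of a branch of level n is at most 2 m /
   sigma_n: one m for X at its end, one for the root term. *)
pose b := expR (- (kappa / A * (2 * m%:R / sigma n))).
have Vb w : bounded_set X m w -> b <= V w.
  move=> Xw; have [t tn Vt] := exists_path_weight xi c n w.
  have tlevel : t \in level n by rewrite mem_level tn.
  rewrite /V (big_rem t)//= Vt ler_wpDr ?sumr_ge0//.
    by move=> v _; exact: path_weight_ge0.
  rewrite ler_expR lerN2.
  have -> : \sum_(0 <= k < n) c k * xi (take k.+1 t) w =
      kappa / A * \sum_(0 <= k < n) alpha k.+1 * xi (take k.+1 t) w.
    by rewrite mulr_sumr; apply: eq_bigr => k _; rewrite mulrA.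
  rewrite ler_wpM2l ?divr_ge0 ?(ltW kappa0) ?(ltW A0)//.
  rewrite ler_pdivlMr// mulrC.
  rewrite -(big_add1 _ _ 0 n.+1 xpredT (fun k => alpha k * xi (take k t) w)).
  have := Xw t; rewrite /X tree_processE tn (big_ltn (m := 0%N))// take0 mulrDr.
  have := Xw [::]; rewrite /X tree_processE /= big_nat1.
  rewrite !ler_norml => /andP[x1 x2] /andP[y1 y2].
  set x := alpha 0%N * _ in x1 x2 y1 y2.
  (* The bound at the root involves [sigma 0]; for negative [x] monotonicity of [sigma] transfers it
     to [sigma n]. *)
  have : - m%:R <= sigma n * x.
    have [x0|x0] := lerP 0 x.
      by apply: (@le_trans _ _ 0); rewrite ?oppr_le0// mulr_ge0// ltW.
    by apply: le_trans x1 _; rewrite ler_wnM2r ?(ltW x0)// sigma_noninc.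
  lra.
have : (b%:E * P (bounded_set X m) <= (expR (- (kappa * kappa)))%:E)%E.
  apply: le_trans iV.
  rewrite -[X in P X]setIT -integral_indic// -ge0_integralZl//; last 2 first.
  - by apply/measurable_EFinP; exact: measurable_indic.
  - by rewrite lee_fin expR_ge0.
  apply: ge0_le_integral => //.
  - by move=> w _; rewrite -EFinM lee_fin mulr_ge0// expR_ge0.
  - by apply/measurable_EFinP; apply: measurable_funM => //; exact: measurable_indic.
  - exact/measurable_EFinP.
  - move=> w _; rewrite -EFinM lee_fin indicE; case: (boolP (_ \in _)) => wX.
      by rewrite mulr1 Vb// -in_setE.
    by rewrite mulr0.
move=> bP.
have : (b%:E * (expR (- (kappa * kappa / 2)))%:E <= (expR (- (kappa * kappa)))%:E)%E.
  by apply: le_trans bP; rewrite lee_wpmul2l ?lee_fin ?expR_ge0// ltW.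
rewrite -EFinM lee_fin -expRD ler_expR => ineq.
have sA0 : 0 < sigma n * A by rewrite mulr_gt0.
have bE : kappa / A * (2 * m%:R / sigma n) = kappa * (2 * m%:R / (sigma n * A)).
  by field; rewrite !lt0r_neq0.
have : kappa * (kappa / 2) <= kappa * (2 * m%:R / (sigma n * A)).
  by rewrite -bE; lra.
rewrite ler_pM2l// ler_pdivlMr// => h.
rewrite ler_pdivlMr//; lra.
Qed.

Unset Implicit Arguments.
Set Strict Implicit.

Theorem theorem6p1 (R : realType) (d : measure_display)
    (Omega : measurableType d) (P : probability Omega R)
    (xi : binary_tree -> {RV P >-> R}) (hxi : iid_standard_normal xi)
    (alpha sigma : nat -> R)
    (alpha_gt0 : forall k, 0 < alpha k) (sigma_gt0 : forall k, 0 < sigma k)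
    (sigma_noninc : nonincreasing_seq sigma) :
  let X := tree_process alpha sigma (fun v => xi v : Omega -> R) in
  (as_bounded P X -> (G_sup alpha sigma < +oo)%E) /\
  ((Q_sup alpha < +oo)%E ->
    (as_bounded P X <-> (G_sup alpha sigma < +oo)%E)).
Proof.
split=> [|Qlty]; first exact: G_sup_lty.
by split=> [|Glty]; [exact: G_sup_lty|exact: as_bounded_tree_process].
Qed.
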